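(* Let $k$ be a field of characteristic zero, let $S$ be a monoid and let $A$ be an $S$-graded $k$-algebra. Then the monoid $G((kS)^\circ)$ acts on $A$.
   Context: Algebras are unital associative $k$-algebras. An algebra $A$ is $S$-graded if $A=\bigoplus_{s\in S}A_s$ with $A_s$ subspaces such that $A_sA_t\subseteq A_{st}$ for all $s,t\in S$. A monoid $M$ acts on a $k$-algebra $A$ if there is a monoid homomorphism $\alpha:M\to\mathrm{End}(A)$, where $\mathrm{End}(A)$ is the monoid of algebra endomorphisms of $A$. $kS$ is the monoid algebra, a bialgebra with $\Delta(s)=s\otimes s$, $\epsilon(s)=1$ for $s\in S$. The finite dual of an algebra $H$ is $H^\circ=\{f\in \mathrm{Hom}_k(H,k)\mid f(I)=0 \text{ for some ideal } I\subseteq H \text{ with } \dim(H/I)<\infty\}$; for $H=kS$ it is a bialgebra with pointwise product on $S$, coproduct determined by $\Delta'(f)(x\otimes y)=f(xy)$, and counit $\epsilon'(f)=f(1)$. For a coalgebra $(C,\Delta,\epsilon)$, $G(C)=\{c\in C\mid \Delta(c)=c\otimes c,\ \epsilon(c)=1\}$ is the set of group-like elements; if $C$ is a bialgebra, $G(C)$ is a monoid under the multiplication of $C$. *)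

(* Defs.v *)
From HB Require Import structures.
From mathcomp Require Import all_boot all_order all_algebra finmap.
From mathcomp.multinomials Require Import monalg.
From mathcomp Require Import boolp classical_sets functions.

Set Implicit Arguments.
Unset Strict Implicit.
Unset Printing Implicit Defensive.

Import GRing.Theory.

Local Open Scope ring_scope.
Local Open Scope quotient_scope.

Section Tensor.
Variable k : fieldType.

Definition bilin (V W Z : lmodType k) (b : V -> W -> Z) : Prop :=
  (forall v, linear (b v)) /\ (forall w, linear (b^~ w)).

Section TensorDef.
Variables V W : lmodType k.

Definition tsum (Z : lmodType k) (b : V -> W -> Z) (s : seq (V * W)) : Z :=
  \sum_(p <- s) b p.1 p.2.

(* V (x) W is the set of formal sums of pairs, two sums being identified when
   no bilinear map separates them, i.e. when they agree in V (x) W. *)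
Definition tensor_eqv (s t : seq (V * W)) : bool :=
  `[< forall (Z : lmodType k) (b : V -> W -> Z),
        bilin b -> tsum b s = tsum b t >].

Lemma tensor_eqv_refl : reflexive tensor_eqv.
Proof. by move=> s; apply/asboolP. Qed.

Lemma tensor_eqv_sym : symmetric tensor_eqv.
Proof. by move=> s t; apply: asbool_equiv_eq; split=> h Z b /h. Qed.

Lemma tensor_eqv_trans : transitive tensor_eqv.
Proof.
move=> t s u /asboolP h1 /asboolP h2; apply/asboolP => Z b bb.
by rewrite h1 // h2.
Qed.

Canonical tensor_equiv :=
  EquivRel tensor_eqv tensor_eqv_refl tensor_eqv_sym tensor_eqv_trans.

Definition tensor := {eq_quot tensor_equiv}.

HB.instance Definition _ := Choice.on tensor.
HB.instance Definition _ := Quotient.on tensor.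

Definition tens (v : V) (w : W) : tensor := \pi_tensor [:: (v, w)].

(* The map out of V (x) W induced by b (meaningful when b is bilinear). *)
Definition tlift (Z : lmodType k) (b : V -> W -> Z) (t : tensor) : Z :=
  tsum b (repr t).

Lemma tlift_pi (Z : lmodType k) (b : V -> W -> Z) s : bilin b ->
  tlift b (\pi_tensor s) = tsum b s.
Proof.
move=> bb; rewrite /tlift.
have : repr (\pi_tensor s) = s %[mod tensor] by rewrite reprK.
by move/eqquotP => /asboolP; apply.
Qed.

Lemma tensorP (t u : tensor) :
  (forall (Z : lmodType k) (b : V -> W -> Z), bilin b ->
     tlift b t = tlift b u) -> t = u.
Proof.
move=> h; rewrite -[t]reprK -[u]reprK; apply/eqquotP/asboolP => Z b bb.
exact: h.
Qed.

Definition tensor0 : tensor := \pi_tensor [::].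
Definition tensor_add (t u : tensor) : tensor := \pi_tensor (repr t ++ repr u).
Definition tensor_scale (a : k) (t : tensor) : tensor :=
  \pi_tensor [seq (a *: p.1, p.2) | p <- repr t].

Section Lift.
Variables (Z : lmodType k) (b : V -> W -> Z) (bb : bilin b).

Lemma bilinDl v v' w : b (v + v') w = b v w + b v' w.
Proof. by have := bb.2 w 1 v v'; rewrite !scale1r. Qed.
Lemma bilinDr v w w' : b v (w + w') = b v w + b v w'.
Proof. by have := bb.1 v 1 w w'; rewrite !scale1r. Qed.
Lemma bilin0l w : b 0 w = 0.
Proof. by apply: (addrI (b 0 w)); rewrite -bilinDl !addr0. Qed.
Lemma bilin0r v : b v 0 = 0.
Proof. by apply: (addrI (b v 0)); rewrite -bilinDr !addr0. Qed.
Lemma bilinZl a v w : b (a *: v) w = a *: b v w.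
Proof. by have := bb.2 w a v 0; rewrite !addr0 bilin0l addr0. Qed.
Lemma bilinZr a v w : b v (a *: w) = a *: b v w.
Proof. by have := bb.1 v a w 0; rewrite !addr0 bilin0r addr0. Qed.

Lemma tlift_0 : tlift b tensor0 = 0.
Proof. by rewrite tlift_pi // /tsum big_nil. Qed.
Lemma tlift_add t u : tlift b (tensor_add t u) = tlift b t + tlift b u.
Proof. by rewrite tlift_pi // /tsum big_cat. Qed.
Lemma tlift_scale a t : tlift b (tensor_scale a t) = a *: tlift b t.
Proof.
rewrite tlift_pi // /tsum big_map scaler_sumr.
by apply: eq_bigr => p _; rewrite bilinZl.
Qed.
End Lift.

Lemma tensor_addA : associative tensor_add.
Proof. by move=> x y z; apply: tensorP => Z b bb; rewrite !tlift_add// addrA. Qed.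
Lemma tensor_addC : commutative tensor_add.
Proof. by move=> x y; apply: tensorP => Z b bb; rewrite !tlift_add// addrC. Qed.
Lemma tensor_add0 : left_id tensor0 tensor_add.
Proof.
by move=> x; apply: tensorP => Z b bb; rewrite tlift_add// tlift_0// add0r.
Qed.
Lemma tensor_addN : left_inverse tensor0 (tensor_scale (-1)) tensor_add.
Proof.
move=> x; apply: tensorP => Z b bb.
by rewrite tlift_add// tlift_scale// tlift_0// scaleN1r addNr.
Qed.

HB.instance Definition _ := GRing.isZmodule.Build tensor
  tensor_addA tensor_addC tensor_add0 tensor_addN.

Lemma tensor_scaleA a c t :
  tensor_scale a (tensor_scale c t) = tensor_scale (a * c) t.
Proof. by apply: tensorP => Z b bb; rewrite !tlift_scale// scalerA. Qed.
Lemma tensor_scale1 : left_id 1 tensor_scale.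
Proof. by move=> t; apply: tensorP => Z b bb; rewrite !tlift_scale// scale1r. Qed.
Lemma tensor_scaleDr : right_distributive tensor_scale +%R.
Proof.
move=> a t u; apply: tensorP => Z b bb.
by rewrite tlift_scale// !tlift_add// !tlift_scale// scalerDr.
Qed.
Lemma tensor_scaleDl t : {morph tensor_scale^~ t : a c / a + c}.
Proof.
move=> a c; apply: tensorP => Z b bb.
by rewrite tlift_add// !tlift_scale// scalerDl.
Qed.

HB.instance Definition _ := GRing.Zmodule_isLmodule.Build k tensor
  tensor_scaleA tensor_scale1 tensor_scaleDr tensor_scaleDl.

Lemma tlift_linear (Z : lmodType k) (b : V -> W -> Z) :
  bilin b -> linear (tlift b).
Proof.
by move=> bb a t u; rewrite [LHS]tlift_add// [X in X + _]tlift_scale.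
Qed.

Lemma tlift_tens (Z : lmodType k) (b : V -> W -> Z) v w :
  bilin b -> tlift b (tens v w) = b v w.
Proof. by move=> bb; rewrite tlift_pi // /tsum big_seq1. Qed.

Lemma tlift_sum (Z : lmodType k) (b : V -> W -> Z) I (r : seq I) F :
  bilin b -> tlift b (\sum_(i <- r) F i) = \sum_(i <- r) tlift b (F i).
Proof.
move=> bb; apply: (big_morph (tlift b)); last exact: tlift_0.
by move=> t u; rewrite [LHS]tlift_add.
Qed.

Lemma bilin_tens : bilin tens.
Proof.
split=> [v a w w'|w a v v']; apply: tensorP => Z b bb;
  rewrite tlift_linear // !tlift_tens //.
  by rewrite bilinDr // bilinZr.
by rewrite bilinDl // bilinZl.
Qed.

Lemma tensor_sum t : t = \sum_(p <- repr t) tens p.1 p.2.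
Proof.
apply: tensorP => Z b bb; rewrite tlift_sum //.
by apply: eq_bigr => p _; rewrite tlift_tens.
Qed.

Lemma linear_tensor_eq (Z : lmodType k) (f g : tensor -> Z) :
  linear f -> linear g -> (forall v w, f (tens v w) = g (tens v w)) -> f =1 g.
Proof.
move=> lf lg fg t; rewrite [t]tensor_sum.
have lin0 (h : tensor -> Z) : linear h -> h 0 = 0.
  by move=> lh; have := lh (-1) 0 0; rewrite scaler0 addr0 scaleN1r addNr.
have linD (h : tensor -> Z) : linear h -> {morph h : x y / x + y}.
  by move=> lh x y; have := lh 1 x y; rewrite !scale1r.
rewrite (big_morph f (linD _ lf) (lin0 _ lf)).
rewrite (big_morph g (linD _ lg) (lin0 _ lg)).
exact: eq_bigr.
Qed.

End TensorDef.

End Tensor.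

Arguments tensor {k} V W.
Arguments tens {k V W} v w.
Arguments tlift {k V W Z} b t.

HB.mixin Record Lmodule_isCoalgebra (k : fieldType) C of GRing.Lmodule k C := {
  comul : C -> tensor C C;
  counit : C -> k^o;
  comul_linear : linear comul;
  counit_linear : linear counit;
  comulA : forall c : C,
    tlift (fun a b => tlift (fun a1 a2 => tens a1 (tens a2 b)) (comul a))
          (comul c)
    = tlift (fun a b => tens a (comul b)) (comul c);
  counitl : forall c : C, tlift (fun a b => counit a *: b) (comul c) = c;
  counitr : forall c : C, tlift (fun a b => counit b *: a) (comul c) = c;
}.

#[short(type="coalgType")]
HB.structure Definition Coalgebra (k : fieldType) :=
  {C of GRing.Lmodule k C & Lmodule_isCoalgebra k C}.

(* The product of the algebra A (x) A: (a (x) b) (c (x) d) = ac (x) bd. *)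
Definition tensor_mul (k : fieldType) (A : algType k) (t u : tensor A A) :
    tensor A A :=
  tlift (fun a b => tlift (fun c d => tens (a * c) (b * d)) u) t.

HB.mixin Record Coalgebra_isBialgebra (k : fieldType) B
    of Coalgebra k B & GRing.Algebra k B := {
  comul1 : comul (1 : B) = tens 1 1;
  comulM : forall x y : B, comul (x * y) = tensor_mul (comul x) (comul y);
  counit1 : counit (1 : B) = 1;
  counitM : forall x y : B, counit (x * y) = (counit x : k) * counit y;
}.

#[short(type="bialgType")]
HB.structure Definition Bialgebra (k : fieldType) :=
  {B of Coalgebra k B & GRing.Algebra k B & Coalgebra_isBialgebra k B}.

Section GroupLike.
Variables (k : fieldType) (C : coalgType k).

Definition is_grouplike : {pred C} :=
  fun c => `[< comul c = tens c c /\ counit c = 1 >].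

Record grouplike := GroupLike {
  grouplike_val :> C;
  grouplikeP : grouplike_val \in is_grouplike
}.

HB.instance Definition _ := [isSub for grouplike_val].
HB.instance Definition _ := [Choice of grouplike by <:].

End GroupLike.

Arguments is_grouplike {k} C.

Section TensorMul.
Variables (k : fieldType) (A : algType k).

Lemma bilin_tensor_mul_aux (a b : A) :
  bilin (fun c d : A => tens (a * c) (b * d)).
Proof.
have bt := @bilin_tens k A A.
split=> [v c w w'|w c v v'].
  by rewrite mulrDr -scalerAr bt.1.
by rewrite mulrDr -scalerAr; have := bt.2 (b * w) c (a * v) (a * v').
Qed.

Lemma tensor_mul_tens (a b c d : A) :
  tensor_mul (tens a b) (tens c d) = tens (a * c) (b * d).
Proof.
rewrite /tensor_mul tlift_pi; last first.
  have bt := @bilin_tens k A A.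
  split=> [v e w w'|w e v v'].
    set L := (LHS); set R := (RHS); rewrite /L /R.
    rewrite (tensor_sum (tens c d)) !tlift_sum; try exact: bilin_tensor_mul_aux.
    rewrite scaler_sumr -big_split /=; apply: eq_bigr => p _.
    rewrite !tlift_tens; try exact: bilin_tensor_mul_aux.
    by rewrite mulrDl -scalerAl bt.1.
  rewrite (tensor_sum (tens c d)) !tlift_sum; try exact: bilin_tensor_mul_aux.
  rewrite scaler_sumr -big_split /=; apply: eq_bigr => p _.
  rewrite !tlift_tens; try exact: bilin_tensor_mul_aux.
  rewrite mulrDl -scalerAl.
  by have := bt.2 (w * p.2) e (v * p.1) (v' * p.1).
by rewrite /tsum big_seq1 tlift_tens //; exact: bilin_tensor_mul_aux.
Qed.

End TensorMul.

Section GroupLikeMonoid.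
Variables (k : fieldType) (B : bialgType k).
Implicit Types g h : grouplike B.

Fact grouplike_one_subproof : (1 : B) \in is_grouplike B.
Proof. by apply/asboolP; split; [exact: comul1|exact: counit1]. Qed.

Fact grouplike_mul_subproof g h :
  (grouplike_val g * grouplike_val h) \in is_grouplike B.
Proof.
have /asboolP[cg eg] := grouplikeP g; have /asboolP[ch eh] := grouplikeP h.
apply/asboolP; split; first by rewrite comulM cg ch tensor_mul_tens.
by rewrite counitM eg eh mulr1.
Qed.

Definition grouplike_one : grouplike B := GroupLike grouplike_one_subproof.
Definition grouplike_mul g h : grouplike B :=
  GroupLike (grouplike_mul_subproof g h).

Fact grouplike_mulA : associative grouplike_mul.
Proof. by move=> f g h; apply: val_inj; rewrite /= mulrA. Qed.
Fact grouplike_mul1 : left_id grouplike_one grouplike_mul.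
Proof. by move=> f; apply: val_inj; rewrite /= mul1r. Qed.
Fact grouplike_1mul : right_id grouplike_one grouplike_mul.
Proof. by move=> f; apply: val_inj; rewrite /= mulr1. Qed.

HB.instance Definition _ := monoid.isMonoid.Build (grouplike B)
  grouplike_mulA grouplike_mul1 grouplike_1mul.

End GroupLikeMonoid.

Section AlgEnd.
Variables (k : fieldType) (A : algType k).

Definition alg_end := {lrmorphism A -> A}.

HB.instance Definition _ := gen_eqMixin alg_end.
HB.instance Definition _ := gen_choiceMixin alg_end.

Lemma alg_endP (f g : alg_end) : (f : A -> A) =1 g -> f = g.
Proof.
case: f g => f [[m1] [m2] [m3]] [g [[n1] [n2] [n3]]] /= /funext fg.
move: m1 m2 m3; rewrite fg => m1 m2 m3.
by rewrite (Prop_irrelevance m1 n1) (Prop_irrelevance m2 n2)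
           (Prop_irrelevance m3 n3).
Qed.

Definition alg_end_one : alg_end := idfun.
Definition alg_end_mul (f g : alg_end) : alg_end := f \o g.

Fact alg_end_mulA : associative alg_end_mul.
Proof. by move=> f g h; apply: alg_endP. Qed.
Fact alg_end_mul1 : left_id alg_end_one alg_end_mul.
Proof. by move=> f; apply: alg_endP. Qed.
Fact alg_end_1mul : right_id alg_end_one alg_end_mul.
Proof. by move=> f; apply: alg_endP. Qed.

HB.instance Definition _ := monoid.isMonoid.Build alg_end
  alg_end_mulA alg_end_mul1 alg_end_1mul.

End AlgEnd.

Section MonoidAlgebra.
Variables (k : fieldType) (S : monoidType).

(* The ring structure of {malg k[S]} in the multinomials library requires that
   s t = 1 imply s = t = 1 in S, hence this copy for arbitrary monoids. *)
Definition monoid_algebra := {malg k[S]}.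

HB.instance Definition _ := GRing.Lmodule.on monoid_algebra.

Definition mbasis (s : S) : monoid_algebra := << s >>.

Definition mlin (V : lmodType k) (phi : S -> V) (x : monoid_algebra) : V :=
  \sum_(s <- msupp x) x@_s *: phi s.

Lemma mlinEw (V : lmodType k) (phi : S -> V) (d : {fset S}) x :
  (msupp x `<=` d)%fset -> mlin phi x = \sum_(s <- d) x@_s *: phi s.
Proof.
move=> le; rewrite /mlin (big_fset_incl _ le) //= => s _ /mcoeff_outdom ->.
by rewrite scale0r.
Qed.

Lemma mlin_linear (V : lmodType k) (phi : S -> V) : linear (mlin phi).
Proof.
move=> a x y; pose d := (msupp x `|` msupp y `|` msupp (a *: x + y)%R)%fset.
rewrite !(@mlinEw _ _ d); last first.
- by apply/fsubsetP => s sx; rewrite !inE sx ?orbT.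
- by apply/fsubsetP => s sx; rewrite !inE sx ?orbT.
- by apply/fsubsetP => s sx; rewrite !inE sx ?orbT.
rewrite scaler_sumr -big_split /=; apply: eq_bigr => s _.
by rewrite mcoeffD mcoeffZ scalerDl scalerA.
Qed.

HB.instance Definition _ (V : lmodType k) (phi : S -> V) :=
  GRing.isLinear.Build k monoid_algebra V *:%R (mlin phi) (mlin_linear phi).

Lemma mlin_basis (V : lmodType k) (phi : S -> V) s :
  mlin phi (mbasis s) = phi s.
Proof.
by rewrite (@mlinEw _ _ [fset s]%fset) ?msuppU_le // big_seq_fset1 mcoeffUU
           scale1r.
Qed.

Lemma monoid_algebraE (x : monoid_algebra) :
  x = \sum_(s <- msupp x) x@_s *: mbasis s.
Proof.
rewrite {1}[x]monalgE; apply: eq_bigr => s _.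
by apply/malgP => t; rewrite mcoeffZ !mcoeffU mulrnAr mulr1.
Qed.

Lemma mlin_ext (V : lmodType k) (f g : monoid_algebra -> V) :
  linear f -> linear g -> (forall s, f (mbasis s) = g (mbasis s)) -> f =1 g.
Proof.
move=> lf lg fg x.
pose F : {linear monoid_algebra -> V} :=
  HB.pack f (GRing.isLinear.Build _ _ _ _ f lf).
pose G : {linear monoid_algebra -> V} :=
  HB.pack g (GRing.isLinear.Build _ _ _ _ g lg).
rewrite -[f x]/(F x) -[g x]/(G x) [x]monoid_algebraE !linear_sum.
by apply: eq_bigr => s _; rewrite !linearZ; congr (_ *: _); exact: fg.
Qed.

Definition monoid_algebra_one : monoid_algebra := mbasis 1%g.

Definition monoid_algebra_mul (x y : monoid_algebra) : monoid_algebra :=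
  mlin (fun s => mlin (fun t => mbasis (s * t)%g) y) x.

Lemma mmul_linearl y : linear (monoid_algebra_mul^~ y).
Proof. exact: mlin_linear. Qed.

Lemma mmul_linearr x : linear (monoid_algebra_mul x).
Proof.
have mmulE y : monoid_algebra_mul x y =
  \sum_(s <- msupp x) x@_s *: mlin (fun t => mbasis (s * t)%g) y by [].
move=> a y z; rewrite !mmulE scaler_sumr -big_split /=.
by apply: eq_bigr => s _; rewrite linearP scalerDr !scalerA mulrC.
Qed.

Lemma mmul_basis s t :
  monoid_algebra_mul (mbasis s) (mbasis t) = mbasis (s * t)%g.
Proof. by rewrite /monoid_algebra_mul !mlin_basis. Qed.

Fact mmulA : associative monoid_algebra_mul.
Proof.
pose m := monoid_algebra_mul.
move=> x y z.
apply: (@mlin_ext _ (fun z => m x (m y z)) (m (m x y))) z => [a u v|a u v|u].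
- by rewrite /m !mmul_linearr.
- by rewrite /m mmul_linearr.
apply: (@mlin_ext _ (fun y => m x (m y (mbasis u)))
                    (fun y => m (m x y) (mbasis u))) y => [a v w|a v w|t].
- by rewrite /m mmul_linearl mmul_linearr.
- by rewrite /m mmul_linearr mmul_linearl.
apply: (@mlin_ext _ (m^~ (m (mbasis t) (mbasis u)))
                    (fun x => m (m x (mbasis t)) (mbasis u))) x => [a v w|a v w|s].
- by rewrite /m mmul_linearl.
- by rewrite /m !mmul_linearl.
by rewrite /m !mmul_basis mulgA.
Qed.

Fact mmul1 : left_id monoid_algebra_one monoid_algebra_mul.
Proof.
apply: mlin_ext => [a v w|//|s]; first by rewrite mmul_linearr.
by rewrite mmul_basis mul1g.
Qed.

Fact mmulr1 : right_id monoid_algebra_one monoid_algebra_mul.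
Proof.
apply: mlin_ext => [a v w|//|s]; first by rewrite mmul_linearl.
by rewrite mmul_basis mulg1.
Qed.

Fact mmulDl : left_distributive monoid_algebra_mul +%R.
Proof.
by move=> x y z; have := mmul_linearl z 1 x y; rewrite !scale1r.
Qed.

Fact mmulDr : right_distributive monoid_algebra_mul +%R.
Proof.
by move=> x y z; have := mmul_linearr x 1 y z; rewrite !scale1r.
Qed.

Fact mone_neq0 : monoid_algebra_one != 0.
Proof.
apply/eqP => /malgP /(_ 1%g) /eqP.
by rewrite mcoeffUU mcoeff0 oner_eq0.
Qed.

HB.instance Definition _ := GRing.Zmodule_isNzRing.Build monoid_algebra
  mmulA mmul1 mmulr1 mmulDl mmulDr mone_neq0.

Fact mmulZl (a : k) (x y : monoid_algebra) : a *: (x * y) = (a *: x) * y.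
Proof.
have mul0 : monoid_algebra_mul 0 y = 0 by exact: linear0.
by have := mmul_linearl y a x 0; rewrite !addr0 mul0 addr0.
Qed.

Fact mmulZr (a : k) (x y : monoid_algebra) : a *: (x * y) = x * (a *: y).
Proof.
have mul0 : monoid_algebra_mul x 0 = 0.
  by have := mmul_linearr x (-1) 0 0; rewrite scaler0 addr0 scaleN1r addNr.
by have := mmul_linearr x a y 0; rewrite !addr0 mul0 addr0.
Qed.

HB.instance Definition _ := GRing.Lmodule_isLalgebra.Build k monoid_algebra
  mmulZl.
HB.instance Definition _ := GRing.Lalgebra_isAlgebra.Build k monoid_algebra
  mmulZr.

Lemma mbasisM s t : mbasis s * mbasis t = mbasis (s * t)%g.
Proof. exact: mmul_basis. Qed.

End MonoidAlgebra.

Arguments mbasis {k S} s.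

Section FiniteCodim.
Variable k : fieldType.

(* dim (V / I) = n, through an isomorphism V / I = k^n *)
Definition finite_codim (V : lmodType k) (I : set V) : Prop :=
  exists n, exists phi : {linear V -> 'rV[k]_n},
    (forall v, exists x, phi x = v) /\ (forall x, I x <-> phi x = 0).

Lemma rows_basis (X : Type) n (F : X -> 'rV[k]_n) :
  exists m (xs : 'I_m -> X) (B := \matrix_(j < m) F (xs j)),
    row_free B /\ (forall x, (F x <= B)%MS).
Proof.
pose P m := `[< exists xs : 'I_m -> X, row_free (\matrix_(j < m) F (xs j)) >].
have exP : exists m, P m.
  exists 0; apply/asboolP.
  have xs : 'I_0 -> X by case.
  by exists xs; rewrite /row_free -leqn0 rank_leq_row.
have ubP m : P m -> (m <= n)%N.
  by move=> /asboolP[xs /eqP <-]; exact: rank_leq_col.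
case: (ex_maxnP exP ubP) => m /asboolP[xs fB] maxm.
exists m, xs; split=> // x; apply/negPn/negP => nx.
set B := \matrix_(j < m) F (xs j) in fB nx.
suff : P m.+1 by move/maxm; rewrite ltnn.
apply/asboolP.
exists (fun i : 'I_(1 + m) => match fintype.split i with inl _ => x | inr j => xs j end).
have -> : (\matrix_(i < 1 + m)
    F (match fintype.split i with inl _ => x | inr j => xs j end)) = col_mx (F x) B.
  apply/row_matrixP => i; rewrite rowK; case: (split_ordP i) => j ->.
    by rewrite rowKu row_id.
  by rewrite rowKd rowK.
have ltB : (B < F x + B)%MS.
  rewrite ltmxE addsmxSr /=; apply: contra nx => h.
  exact: submx_trans (addsmxSl _ _) h.
have := rank_ltmx ltB.
rewrite (eqP fB) => lt.
rewrite /row_free eqn_leq rank_leq_row /=.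
by have [<- _] := addsmxE (F x) B.
Qed.

Lemma finite_codim_ker (V : lmodType k) n (phi : {linear V -> 'rV[k]_n}) :
  finite_codim [set x | phi x = 0].
Proof.
have [m [xs [fB sB]]] := rows_basis phi.
set B := \matrix_j _ in fB sB.
pose psi x := phi x *m pinvmx B.
have lpsi : linear psi by move=> a x y; rewrite /psi linearP mulmxDl scalemxAl.
pose Psi : {linear V -> 'rV[k]_m} :=
  HB.pack psi (GRing.isLinear.Build _ _ _ _ psi lpsi).
have psiK x : psi x *m B = phi x by rewrite mulmxKpV.
exists m, Psi; split=> [v|x] /=.
  exists (\sum_j v 0 j *: xs j); apply: (row_free_inj fB).
  rewrite psiK linear_sum mulmx_sum_row; apply: eq_bigr => j _.
  by rewrite linearZ rowK.
split=> [h|h]; first by rewrite /psi h mul0mx.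
by rewrite -psiK [psi x]h mul0mx.
Qed.

End FiniteCodim.

(* Injectivity of V (x) W -> k^(X x Y) for spaces of functions V on X and
   W on Y. *)
Lemma tensor_eval_inj (k : fieldType) (X Y : Type) (V W : lmodType k)
    (i : V -> X -> k^o) (j : W -> Y -> k^o) :
    linear i -> linear j -> injective i -> injective j ->
  forall t : tensor V W,
    (forall x y, tlift (fun v w => (i v x * j w y : k^o)) t = 0) -> t = 0.
Proof.
move=> li lj inji injj t.
pose I : {linear V -> (X -> k^o)} :=
  HB.pack i (GRing.isLinear.Build _ _ _ _ i li).
pose J : {linear W -> (Y -> k^o)} :=
  HB.pack j (GRing.isLinear.Build _ _ _ _ j lj).
have bij x y : bilin (fun v w => (i v x * j w y : k^o)).
  split=> [v a w w'|w a v v'].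
    by rewrite lj /= mulrDr; congr (_ + _); rewrite /GRing.scale /= mulrCA.
  by rewrite li /= mulrDl; congr (_ + _); rewrite /GRing.scale /= mulrA.
have bt := @bilin_tens k V W.
rewrite {2}[t]tensor_sum; set s := repr t => t0.
have {}t0 x y : \sum_(l < size s) i (nth 0 s l).1 x * j (nth 0 s l).2 y = 0.
  by rewrite -[RHS](t0 x y) /tlift /tsum (big_nth 0) big_mkord.
rewrite (big_nth 0) big_mkord.
pose f (l : 'I_(size s)) := (nth 0 s l).1.
pose g (l : 'I_(size s)) := (nth 0 s l).2.
pose F x : 'rV[k]_(size s) := \row_l i (f l) x.
have [m [xs [fB sB]]] := rows_basis F.
set B := \matrix_j _ in fB sB.
pose P := pinvmx B.
pose c (r : 'I_m) : V := \sum_l P l r *: f l.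
have fE l : f l = \sum_r B r l *: c r.
  apply: inji; rewrite -[i]/(I : _ -> _) linear_sum; apply/funext => x.
  have := mulmxKpV (sB x) => /rowP/(_ l); rewrite [RHS]mxE => e.
  rewrite -[LHS]/(i (f l) x) -e mxE.
  rewrite fct_sumE; apply: eq_bigr => r _.
  have -> : I (B r l *: c r) x = B r l * I (c r) x by rewrite linearZ.
  have -> : I (c r) x = (F x *m P) 0 r.
    rewrite linear_sum fct_sumE mxE; apply: eq_bigr => l' _.
    have -> : I (P l' r *: f l') x = P l' r * i (f l') x by rewrite linearZ.
    have -> : F x 0 l' = i (f l') x by rewrite mxE.
    by rewrite [LHS]mulrC.
  exact: mulrC.
have gE r : \sum_l B r l *: g l = 0.
  apply: injj; rewrite -[j]/(J : _ -> _) linear_sum linear0.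
  apply/funext => y; rewrite fct_sumE -[RHS](t0 (xs r) y).
  by apply: eq_bigr => l _; rewrite linearZ !mxE.
transitivity (\sum_(r < m) tens (c r) (\sum_l B r l *: g l)).
  transitivity (\sum_l \sum_r B r l *: tens (c r) (g l)).
    apply: eq_bigr => l _; rewrite -/(f l) -/(g l) fE.
    rewrite (big_morph (fun v => tens v (g l)) (id1 := 0) (op1 := +%R)).
    - by apply: eq_bigr => r _; rewrite bilinZl.
    - by move=> v v'; rewrite bilinDl.
    - by rewrite bilin0l.
  rewrite exchange_big; apply: eq_bigr => r _.
  rewrite (big_morph (fun w => tens (c r) w) (id1 := 0) (op1 := +%R)).
  - by apply: eq_bigr => l _; rewrite bilinZr.
  - by move=> v v'; rewrite bilinDr.
  - by rewrite bilin0r.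
by apply: big1 => r _; rewrite gE bilin0r.
Qed.

Section FiniteDual.
Variables (k : fieldType) (H : algType k).

(* Stability under scalars and opposites follows, as a *: x = a%:A * x. *)
Definition two_sided_ideal (I : set H) : Prop :=
  [/\ I 0, forall x y, I x -> I y -> I (x + y),
      forall h x, I x -> I (h * x) & forall h x, I x -> I (x * h)].

Definition in_finite_dual : {pred (H -> k^o)} := fun f =>
  `[< linear f /\
      exists I : set H,
        [/\ two_sided_ideal I, finite_codim I & forall x, I x -> f x = 0] >].

Lemma in_finite_dualI n (phi : {linear H -> 'rV[k]_n}) (f : H -> k^o) :
  (forall h x, phi x = 0 -> phi (h * x) = 0) ->
  (forall h x, phi x = 0 -> phi (x * h) = 0) ->
  linear f -> (forall x, phi x = 0 -> f x = 0) -> f \in in_finite_dual.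
Proof.
move=> phil phir lf f0; apply/asboolP; split=> //.
exists [set x | phi x = 0]%classic; split=> //; last exact: finite_codim_ker.
split=> //=; first exact: linear0.
by move=> x y px py; rewrite linearD px py addr0.
Qed.

Lemma in_finite_dualE (f : H -> k^o) : f \in in_finite_dual ->
  linear f /\
  exists n (phi : {linear H -> 'rV[k]_n}),
  [/\ forall v, exists x, phi x = v,
      forall h x, phi x = 0 -> phi (h * x) = 0,
      forall h x, phi x = 0 -> phi (x * h) = 0 &
      forall x, phi x = 0 -> f x = 0].
Proof.
move=> /asboolP[lf [I [[_ _ Il Ir] [n [phi [sphi kphi]]] f0]]]; split=> //.
exists n, phi; split=> //.
- by move=> h x /kphi Ix; apply/kphi; exact: Il.
- by move=> h x /kphi Ix; apply/kphi; exact: Ir.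
- by move=> x /kphi; exact: f0.
Qed.

Fact in_finite_dual_submod : submod_closed in_finite_dual.
Proof.
split.
  apply: (@in_finite_dualI 0 \0) => //.
  by move=> a x y; rewrite /= scaler0 addr0.
move=> a f g /in_finite_dualE[lf [n [phi [_ pl pr pf]]]].
move=> /in_finite_dualE[lg [m [psi [_ ql qr qg]]]].
pose chi x := row_mx (phi x) (psi x).
have lchi : linear chi.
  by move=> c x y; rewrite /chi !linearP scale_row_mx add_row_mx.
pose Chi : {linear H -> 'rV[k]_(n + m)} :=
  HB.pack chi (GRing.isLinear.Build _ _ _ _ chi lchi).
have chi0 x : Chi x = 0 <-> phi x = 0 /\ psi x = 0.
  rewrite -[Chi x]/(chi x) /chi; split=> [|[-> ->]]; last exact: row_mx0.
  by rewrite -row_mx0 => /eq_row_mx.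
apply: (@in_finite_dualI _ Chi).
- by move=> h x /chi0[px qx]; apply/chi0; split; [exact: pl|exact: ql].
- by move=> h x /chi0[px qx]; apply/chi0; split; [exact: pr|exact: qr].
- move=> c x y; rewrite /= !fctE lf lg !scalerDr !scalerA [c * a]mulrC.
  by rewrite addrACA.
- by move=> x /chi0[px qx]; rewrite !fctE pf // qg // scaler0 addr0.
Qed.

HB.instance Definition _ :=
  GRing.isSubmodClosed.Build k (H -> k^o) in_finite_dual in_finite_dual_submod.

Record finite_dual := FiniteDual {
  finite_dual_fun :> H -> k^o;
  finite_dualP : finite_dual_fun \in in_finite_dual
}.

HB.instance Definition _ := [isSub for finite_dual_fun].
HB.instance Definition _ := [Choice of finite_dual by <:].
HB.instance Definition _ := [SubChoice_isSubLmodule of finite_dual by <:].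

Implicit Types f g : finite_dual.

Lemma finite_dual_linear f : linear f.
Proof. by have /asboolP[] := finite_dualP f. Qed.

Lemma fdD f g x : (f + g) x = f x + g x. Proof. by []. Qed.
Lemma fdZ a f x : (a *: f) x = a * f x. Proof. by []. Qed.
Lemma fd_sum I (r : seq I) (F : I -> finite_dual) x :
  (\sum_(i <- r) F i) x = \sum_(i <- r) F i x.
Proof. by elim/big_rec2: _ => // i y1 y2 _ <-. Qed.
Lemma fdP f g : f =1 g -> f = g.
Proof. by move=> fg; apply: val_inj; apply/funext. Qed.

Lemma finite_dual_fun_linear : linear finite_dual_fun.
Proof. by []. Qed.

Lemma finite_dual_fun_inj : injective finite_dual_fun.
Proof. exact: val_inj. Qed.

Definition fdual_eval (t : tensor finite_dual finite_dual) (x y : H) : k^o :=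
  tlift (fun f g : finite_dual => (f x * g y : k^o)) t.

Lemma bilin_fdual_eval x y :
  bilin (fun f g : finite_dual => (f x * g y : k^o)).
Proof.
split=> [f a g g'|g a f f'].
  by rewrite fdD fdZ mulrDr; congr (_ + _); rewrite mulrCA.
by rewrite fdD fdZ mulrDl; congr (_ + _); rewrite -mulrA.
Qed.

Lemma fdual_eval_linear x y : linear (fun t => fdual_eval t x y).
Proof. exact/tlift_linear/bilin_fdual_eval. Qed.

Lemma fdual_eval_tens f g x y : fdual_eval (tens f g) x y = f x * g y.
Proof. by rewrite /fdual_eval tlift_tens //; exact: bilin_fdual_eval. Qed.

Lemma fdual_eval_sum I (r : seq I) F x y :
  fdual_eval (\sum_(i <- r) F i) x y = \sum_(i <- r) fdual_eval (F i) x y.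
Proof. by rewrite /fdual_eval tlift_sum //; exact: bilin_fdual_eval. Qed.

Lemma fdual_eval_inj (t u : tensor finite_dual finite_dual) :
  (forall x y, fdual_eval t x y = fdual_eval u x y) -> t = u.
Proof.
move=> tu; apply/eqP; rewrite -subr_eq0; apply/eqP.
apply: (tensor_eval_inj finite_dual_fun_linear finite_dual_fun_linear
          finite_dual_fun_inj finite_dual_fun_inj) => x y.
rewrite -[LHS]/(fdual_eval _ x y) -scaleN1r addrC fdual_eval_linear tu.
by rewrite scaleN1r addNr.
Qed.

Lemma fdual_comul_subproof f :
  exists t, forall x y, fdual_eval t x y = f (x * y).
Proof.
have [lf [n [phi [sphi pl pr pf]]]] := in_finite_dualE (finite_dualP f).
pose F : {linear H -> k^o} :=
  HB.pack (f : H -> k^o) (GRing.isLinear.Build _ _ _ _ _ lf).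
have /choice[e eE] (i : 'I_n) : exists x, phi x = delta_mx 0 i by exact: sphi.
have gP i : (fun x => f (x * e i)) \in in_finite_dual.
  apply: (@in_finite_dualI _ phi) => //.
    by move=> a x y; rewrite mulrDl -scalerAl lf.
  by move=> x px; apply: pf; exact: pr.
have hP i : (fun x => phi x 0 i : k^o) \in in_finite_dual.
  apply: (@in_finite_dualI _ phi) => //.
    by move=> a x y; rewrite linearP !mxE.
  by move=> x ->; rewrite mxE.
exists (\sum_i tens (FiniteDual (gP i)) (FiniteDual (hP i))) => x y.
rewrite fdual_eval_sum.
have : phi (y - \sum_i phi y 0 i *: e i) = 0.
  rewrite linearB linear_sum /=.
  under eq_bigr do rewrite linearZ /= eE.
  by rewrite -row_sum_delta subrr.
move=> /(pl x)/pf; rewrite -[f _]/(F _) mulrBr linearB => /eqP.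
rewrite subr_eq0 => /eqP; rewrite -[F (x * y)]/(f (x * y)) => ->.
rewrite mulr_sumr linear_sum; apply: eq_bigr => i _.
by rewrite fdual_eval_tens -scalerAr linearZ mulrC.
Qed.

(* Delta'(f) is the unique element of H^o (x) H^o whose pairing with
   x (x) y is f (x * y): see fdual_comulE and fdual_eval_inj. *)
Definition fdual_comul f : tensor finite_dual finite_dual :=
  xget 0 [set t | forall x y, fdual_eval t x y = f (x * y)]%classic.

Lemma fdual_comulE f x y : fdual_eval (fdual_comul f) x y = f (x * y).
Proof.
rewrite /fdual_comul; case: xgetP => [t _ //|].
by have [t tE] := fdual_comul_subproof f => /(_ t).
Qed.

Definition fdual_counit f : k^o := f 1.

Fact fdual_comul_linear : linear fdual_comul.
Proof.
move=> a f g; apply: fdual_eval_inj => x y.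
by rewrite fdual_eval_linear !fdual_comulE.
Qed.

Fact fdual_counit_linear : linear fdual_counit.
Proof. by []. Qed.

Fact fdual_counitl f :
  tlift (fun a b => fdual_counit a *: b) (fdual_comul f) = f.
Proof.
apply: fdP => x; rewrite -[in RHS](mul1r x) -fdual_comulE.
by rewrite /fdual_eval /tlift /tsum fd_sum.
Qed.

Fact fdual_counitr f :
  tlift (fun a b => fdual_counit b *: a) (fdual_comul f) = f.
Proof.
apply: fdP => x; rewrite -[in RHS](mulr1 x) -fdual_comulE.
rewrite /fdual_eval /tlift /tsum fd_sum.
by apply: eq_bigr => p _; rewrite fdZ mulrC.
Qed.

Let eval3 (t : tensor finite_dual (tensor finite_dual finite_dual)) x p : k^o :=
  tlift (fun f u => (f x * fdual_eval u p.1 p.2 : k^o)) t.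

Let bilin_eval3 x (p : H * H) : bilin (fun (f : finite_dual) u =>
  (f x * fdual_eval u p.1 p.2 : k^o)).
Proof.
split=> [f a g g'|g a f f'].
  by rewrite fdual_eval_linear mulrDr; congr (_ + _); rewrite mulrCA.
by rewrite fdD fdZ mulrDl; congr (_ + _); rewrite -mulrA.
Qed.

Let eval3_inj t u : (forall x p, eval3 t x p = eval3 u x p) -> t = u.
Proof.
move=> tu; apply/eqP; rewrite -subr_eq0; apply/eqP.
apply: (@tensor_eval_inj _ _ _ _ _ finite_dual_fun
  (fun u p => fdual_eval u p.1 p.2) finite_dual_fun_linear).
- move=> a v w; apply/funext => p; exact: fdual_eval_linear.
- exact: finite_dual_fun_inj.
- move=> v w vw; apply: fdual_eval_inj => x y.
  by have /funeqP /(_ (x, y)) := vw.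
move=> x p; rewrite -[LHS]/(eval3 _ x p) /eval3 -scaleN1r addrC.
rewrite tlift_linear; last exact: bilin_eval3.
by rewrite -!/(eval3 _ x p) tu scaleN1r addNr.
Qed.

Let eval3_tlift (b : finite_dual -> finite_dual -> tensor finite_dual (tensor finite_dual finite_dual)) t x p :
  eval3 (tlift b t) x p = tlift (fun f g => eval3 (b f g) x p) t.
Proof.
rewrite [X in eval3 X]/tlift /tsum /eval3 tlift_sum //; exact: bilin_eval3.
Qed.

Let eval3_tens f u x p : eval3 (tens f u) x p = f x * fdual_eval u p.1 p.2.
Proof. by rewrite /eval3 tlift_tens //; exact: bilin_eval3. Qed.

Fact fdual_comulA f :
  tlift (fun a b =>
    tlift (fun a1 a2 => tens a1 (tens a2 b)) (fdual_comul a)) (fdual_comul f)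
  = tlift (fun a b => tens a (fdual_comul b)) (fdual_comul f).
Proof.
apply: eval3_inj => x [y z]; rewrite !eval3_tlift.
transitivity (f (x * (y * z))); last first.
  rewrite -fdual_comulE; apply: eq_bigr => p _.
  by rewrite eval3_tens /= fdual_comulE.
rewrite mulrA -fdual_comulE; apply: eq_bigr => -[g h] _ /=.
rewrite eval3_tlift -fdual_comulE /fdual_eval /tlift /tsum mulr_suml.
by apply: eq_bigr => p _; rewrite eval3_tens fdual_eval_tens mulrA.
Qed.

HB.instance Definition _ := Lmodule_isCoalgebra.Build k finite_dual
  fdual_comul_linear fdual_counit_linear fdual_comulA
  fdual_counitl fdual_counitr.

End FiniteDual.

Arguments finite_dual {k} H.
Arguments in_finite_dual {k} H.

Section MonoidDual.
Variables (k : fieldType) (S : monoidType).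
Local Notation kS := (monoid_algebra k S).
Local Notation kSo := (finite_dual kS).
Implicit Types f g h : kSo.

Lemma quotient_action (H : algType k) n (phi : {linear H -> 'rV[k]_n})
    (F : {linear H -> H}) : (forall v, exists x, phi x = v) ->
    (forall x, phi x = 0 -> phi (F x) = 0) ->
  exists L : 'M[k]_n, forall x, phi (F x) = phi x *m L.
Proof.
move=> sphi kphi.
have /choice[e eE] (i : 'I_n) : exists x, phi x = delta_mx 0 i by exact: sphi.
exists (\matrix_i phi (F (e i))) => x.
have : phi (x - \sum_i phi x 0 i *: e i) = 0.
  rewrite linearB linear_sum /=.
  under eq_bigr do rewrite linearZ /= eE.
  by rewrite -row_sum_delta subrr.
move=> /kphi; rewrite !linearB => /eqP; rewrite subr_eq0 => /eqP ->.
rewrite !linear_sum mulmx_sum_row; apply: eq_bigr => i _.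
by rewrite !linearZ rowK.
Qed.

(* The linear functional on kS whose restriction to S is the pointwise product
   of those of f and g. *)
Definition monoid_dual_mul_fun f g : kS -> k^o :=
  mlin (fun s => f (mbasis s) * g (mbasis s) : k^o).

Fact monoid_dual_mul_subproof f g :
  monoid_dual_mul_fun f g \in in_finite_dual kS.
Proof.
have [lf [n [phi [sphi pl pr pf]]]] := in_finite_dualE (finite_dualP f).
have [lg [m [psi [spsi ql qr qg]]]] := in_finite_dualE (finite_dualP g).
pose Phi : {linear kS -> 'rV[k]_(n * m)} :=
  mlin (fun s => mxvec ((phi (mbasis s))^T *m psi (mbasis s))).
have PhiE s : Phi (mbasis s) = mxvec ((phi (mbasis s))^T *m psi (mbasis s)).
  exact: mlin_basis.
have act (F : S -> S) (Fm : {linear kS -> kS}) :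
    (forall s, Fm (mbasis s) = mbasis (F s)) ->
    (forall x, phi x = 0 -> phi (Fm x) = 0) ->
    (forall x, psi x = 0 -> psi (Fm x) = 0) ->
    forall x, Phi x = 0 -> Phi (Fm x) = 0.
  move=> FmE kphi kpsi.
  have [L LE] := quotient_action sphi kphi.
  have [M ME] := quotient_action spsi kpsi.
  have PFE x : Phi (Fm x) = mxvec (L^T *m vec_mx (Phi x) *m M).
    move: x; apply: mlin_ext => [a x y|a x y|s].
    - by rewrite !linearP.
    - by rewrite linearP linearP mulmxDr -scalemxAr mulmxDl -scalemxAl linearP.
    - rewrite FmE !PhiE -FmE LE ME mxvecK trmx_mul.
      by rewrite !mulmxA.
  by move=> x Px; rewrite PFE Px linear0 mulmx0 mul0mx linear0.
apply: (@in_finite_dualI _ _ _ Phi).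
- move=> y x Px; rewrite [y]monoid_algebraE mulr_suml linear_sum.
  apply: big1 => s _; rewrite -scalerAl linearZ.
  pose Fm : {linear kS -> kS} := HB.pack (fun z : kS => mbasis s * z)
    (GRing.isLinear.Build _ _ _ _ (fun z : kS => mbasis s * z)
      (@mmul_linearr k S (mbasis s))).
  suff : Phi (Fm x) = 0 by move=> /= ->; rewrite scaler0.
  apply: (act (fun t => s * t)%g) => // [t|z|z]; first exact: mbasisM.
  - exact: pl.
  - exact: ql.
- move=> y x Px; rewrite [y]monoid_algebraE mulr_sumr linear_sum.
  apply: big1 => s _; rewrite -scalerAr linearZ.
  pose Fm : {linear kS -> kS} := HB.pack (fun z : kS => z * mbasis s)
    (GRing.isLinear.Build _ _ _ _ (fun z : kS => z * mbasis s)
      (@mmul_linearl k S (mbasis s))).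
  suff : Phi (Fm x) = 0 by move=> /= ->; rewrite scaler0.
  apply: (act (fun t => t * s)%g) => // [t|z|z]; first exact: mbasisM.
  - exact: pr.
  - exact: qr.
- exact: mlin_linear.
have /choice[e eE] (i : 'I_n) : exists x, phi x = delta_mx 0 i by exact: sphi.
have /choice[d dE] (j : 'I_m) : exists x, psi x = delta_mx 0 j by exact: spsi.
pose Q : 'M[k]_(n, m) -> k^o := fun A => \sum_i \sum_j A i j * (f (e i) * g (d j)).
have lQ : linear Q.
  move=> a A B; rewrite /Q scaler_sumr -big_split; apply: eq_bigr => i _.
  rewrite scaler_sumr -big_split; apply: eq_bigr => j _ /=.
  by rewrite !mxE mulrDl -mulrA.
have vanish N (chi : {linear kS -> 'rV[k]_N}) (u : kSo) (b : 'I_N -> kS) x :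
    (forall i, chi (b i) = delta_mx 0 i) -> (forall y, chi y = 0 -> u y = 0) ->
    u x = \sum_i chi x 0 i * u (b i).
  move=> bE uE.
  pose U : {linear kS -> k^o} := HB.pack (u : kS -> k^o)
    (GRing.isLinear.Build _ _ _ _ _ (finite_dual_linear u)).
  have : chi (x - \sum_i chi x 0 i *: b i) = 0.
    rewrite linearB linear_sum /=.
    under eq_bigr do rewrite linearZ /= bE.
    by rewrite -row_sum_delta subrr.
  move=> /uE; rewrite -[u _]/(U _) linearB => /eqP; rewrite subr_eq0 => /eqP.
  rewrite -[U x]/(u x) => ->; rewrite linear_sum.
  by apply: eq_bigr => i _; rewrite linearZ.
have QE x : monoid_dual_mul_fun f g x = Q (vec_mx (Phi x)).
  move: x; apply: mlin_ext => [a x y|a x y|s].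
  - exact: mlin_linear.
  - by rewrite !linearP lQ.
  rewrite [LHS]mlin_basis PhiE mxvecK.
  rewrite (vanish _ phi f e) // (vanish _ psi g d) //.
  rewrite mulr_suml; apply: eq_bigr => i _.
  rewrite mulr_sumr; apply: eq_bigr => j _.
  rewrite mxE big_ord1 !mxE mulrACA; congr (_ * _).
move=> x Px; rewrite QE Px linear0 /Q; apply: big1 => i _; apply: big1 => j _.
by rewrite mxE mul0r.
Qed.

Definition monoid_dual_mul f g : kSo := FiniteDual (monoid_dual_mul_subproof f g).

Fact monoid_dual_one_subproof :
  (mlin (fun=> 1) : kS -> k^o) \in in_finite_dual kS.
Proof.
pose u : {linear kS -> k^o} := mlin (fun=> 1).
have uE s : u (mbasis s) = 1 by exact: mlin_basis.
have uM x y : u (x * y) = u x * u y.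
  move: y; apply: (@mlin_ext k S k^o (fun y => u (x * y)) (fun y => u x * u y)).
  - by move=> a y z; rewrite mulrDr -scalerAr linearP.
  - move=> a y z; rewrite linearP mulrDr; congr (_ + _).
    by rewrite /GRing.scale /= mulrCA.
  move=> t; move: x.
  apply: (@mlin_ext k S k^o (fun x => u (x * mbasis t))
                            (fun x => u x * u (mbasis t))).
  - by move=> a y z; rewrite mulrDl -scalerAl linearP.
  - move=> a y z; rewrite linearP mulrDl; congr (_ + _).
    by rewrite /GRing.scale /= mulrA.
  by move=> s; rewrite mbasisM !uE mulr1.
pose phi x : 'rV[k]_1 := const_mx (u x).
have lphi : linear phi.
  by move=> a x y; apply/rowP => i; rewrite !mxE linearP.
pose Phi : {linear kS -> 'rV[k]_1} :=
  HB.pack phi (GRing.isLinear.Build _ _ _ _ phi lphi).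
have Phi0 x : Phi x = 0 <-> u x = 0.
  split=> [/rowP/(_ 0)|ux]; first by rewrite !mxE.
  by apply/rowP => i; rewrite !mxE ux.
apply: (@in_finite_dualI _ _ _ Phi).
- by move=> h x /Phi0 ux; apply/Phi0; rewrite uM ux mulr0.
- by move=> h x /Phi0 ux; apply/Phi0; rewrite uM ux mul0r.
- exact: mlin_linear.
- by move=> x /Phi0.
Qed.

Definition monoid_dual_one : kSo := FiniteDual monoid_dual_one_subproof.

Lemma monoid_dual_mulE f g s :
  monoid_dual_mul f g (mbasis s) = f (mbasis s) * g (mbasis s).
Proof. exact: mlin_basis. Qed.

Lemma monoid_dual_oneE s : monoid_dual_one (mbasis s) = 1.
Proof. exact: mlin_basis. Qed.

Lemma monoid_dualP f g : (forall s, f (mbasis s) = g (mbasis s)) -> f = g.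
Proof. by move=> fg; apply/fdP/mlin_ext => //; exact: finite_dual_linear. Qed.

Fact monoid_dual_mulA : associative monoid_dual_mul.
Proof.
by move=> f g h; apply: monoid_dualP => s; rewrite !monoid_dual_mulE mulrA.
Qed.
Fact monoid_dual_mulC : commutative monoid_dual_mul.
Proof.
by move=> f g; apply: monoid_dualP => s; rewrite !monoid_dual_mulE mulrC.
Qed.
Fact monoid_dual_mul1 : left_id monoid_dual_one monoid_dual_mul.
Proof.
move=> f; apply: monoid_dualP => s.
by rewrite monoid_dual_mulE monoid_dual_oneE mul1r.
Qed.
Fact monoid_dual_mulDl : left_distributive monoid_dual_mul +%R.
Proof.
move=> f g h; apply: monoid_dualP => s.
by rewrite fdD !monoid_dual_mulE fdD mulrDl.
Qed.
Fact monoid_dual_one_neq0 : monoid_dual_one != 0.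
Proof.
apply/eqP => e; have := monoid_dual_oneE 1%g; rewrite e => /eqP.
by rewrite -[X in X == _]/(0 : k) eq_sym oner_eq0.
Qed.

HB.instance Definition _ := GRing.Zmodule_isComNzRing.Build kSo
  monoid_dual_mulA monoid_dual_mulC monoid_dual_mul1 monoid_dual_mulDl
  monoid_dual_one_neq0.

Fact monoid_dual_scaleAl (a : k) f g : a *: (f * g) = a *: f * g.
Proof.
apply: monoid_dualP => s.
have mulE f' g' : (f' * g') (mbasis s) = f' (mbasis s) * g' (mbasis s).
  exact: monoid_dual_mulE.
by rewrite fdZ !mulE fdZ; exact: mulrA.
Qed.
HB.instance Definition _ := GRing.Lmodule_isLalgebra.Build k kSo
  monoid_dual_scaleAl.
Fact monoid_dual_scaleAr (a : k) f g : a *: (f * g) = f * (a *: g).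
Proof. by rewrite mulrC scalerAl mulrC. Qed.
HB.instance Definition _ := GRing.Lalgebra_isAlgebra.Build k kSo
  monoid_dual_scaleAr.

Lemma fdual_eval_ext (t u : tensor kSo kSo) :
  (forall r s, fdual_eval t (mbasis r) (mbasis s)
             = fdual_eval u (mbasis r) (mbasis s)) -> t = u.
Proof.
have linl (v : tensor kSo kSo) y : linear (fun x => fdual_eval v x y).
  move=> a x x'; rewrite /fdual_eval /tlift /tsum scaler_sumr -big_split /=.
  apply: eq_bigr => p _; rewrite finite_dual_linear mulrDl; congr (_ + _).
  by rewrite /GRing.scale /= mulrA.
have linr (v : tensor kSo kSo) x : linear (fdual_eval v x).
  move=> a y y'; rewrite /fdual_eval /tlift /tsum scaler_sumr -big_split /=.
  apply: eq_bigr => p _; rewrite finite_dual_linear mulrDr; congr (_ + _).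
  by rewrite /GRing.scale /= mulrCA.
move=> tu; apply: fdual_eval_inj => x y; move: y.
apply: mlin_ext => [||s]; [exact: linr|exact: linr|].
move: x; apply: (@mlin_ext k S k^o (fun x => fdual_eval t x (mbasis s))
                          (fun x => fdual_eval u x (mbasis s))) => //.
Qed.

Fact monoid_dual_comul1 : comul (1 : kSo) = tens 1 1.
Proof.
apply: fdual_eval_ext => r s.
by rewrite fdual_comulE fdual_eval_tens mbasisM !monoid_dual_oneE mulr1.
Qed.

Fact monoid_dual_comulM f g : comul (f * g) = tensor_mul (comul f) (comul g).
Proof.
apply: fdual_eval_ext => r s.
rewrite fdual_comulE mbasisM monoid_dual_mulE -!mbasisM -!fdual_comulE.
rewrite /tensor_mul [in RHS]/tlift /tsum fdual_eval_sum.
rewrite [in LHS]/fdual_eval [X in X * _]/tlift /tsum mulr_suml.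
apply: eq_bigr => p _.
rewrite /tlift /tsum fdual_eval_sum mulr_sumr; apply: eq_bigr => q _.
by rewrite fdual_eval_tens !monoid_dual_mulE mulrACA.
Qed.

Fact monoid_dual_counit1 : counit (1 : kSo) = 1.
Proof. exact: (monoid_dual_oneE 1%g). Qed.

Fact monoid_dual_counitM f g : counit (f * g) = (counit f : k) * counit g.
Proof. exact: (monoid_dual_mulE f g 1%g). Qed.

HB.instance Definition _ := Coalgebra_isBialgebra.Build k kSo
  monoid_dual_comul1 monoid_dual_comulM monoid_dual_counit1
  monoid_dual_counitM.

End MonoidDual.

(* A family Ad of subspaces of A is a grading when A is their internal direct
   sum, that is when each a is the sum of a unique finitely supported family
   c with c s in A_s, and A_s A_t is contained in A_(st).  It is not required
   that 1 lie in A_1, which for a monoid S does not follow. *)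
Record is_grading (k : fieldType) (S : monoidType) (A : algType k)
    (Ad : S -> {pred A}) : Prop := IsGrading {
  grading_subspace : forall s, submod_closed (Ad s);
  grading_direct_sum : forall a : A, exists! c : {malg A[S]},
    (forall s, c@_s \in Ad s) /\ a = \sum_(s <- msupp c) c@_s;
  grading_mul : forall s t a b,
    a \in Ad s -> b \in Ad t -> a * b \in Ad (s * t)%g
}.

(* Main.v *)
Require Import Defs.
From HB Require Import structures.
From mathcomp Require Import all_boot all_order all_algebra.
From mathcomp Require Import finmap boolp.
From mathcomp.multinomials Require Import monalg.

Set Implicit Arguments.
Unset Strict Implicit.
Unset Printing Implicit Defensive.

Import GRing.Theory.
Local Open Scope ring_scope.

(** A group-like element f of the finite dual of kS is the same thing as a
    monoid morphism from S to the multiplicative monoid of k: pairing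
    comul f = f (x) f with s (x) t gives f(st) = f(s) f(t), and counit f = 1 is
    f(1) = 1 (lemmas [grouplike_evalM] and [grouplike_eval1]). It acts on a
    graded algebra by multiplying the component of degree s by f(s). This map
    is linear because a decomposition into homogeneous components is unique,
    hence linear in the element; it is multiplicative because A_s A_t lies in
    A_(st) and f is multiplicative; and it fixes the unit because f(1) = 1,
    provided that the unit of A is homogeneous of degree 1. Since the product
    of the dual is pointwise on S, the product of group-like elements goes to
    the composition of the scaling maps.

    For a monoid S the unit of A may have components outside A_1, and these
    maps then need not be unital; the trivial action is used in that case. *)

Section GroupLikeEval.
Context {k : fieldType} {S : monoidType}.
Local Notation kS := (monoid_algebra k S).
Implicit Types f g : grouplike (finite_dual kS).

Definition grouplike_eval f (s : S) : k := grouplike_val f (mbasis s).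

Lemma grouplike_eval1 f : grouplike_eval f 1%g = 1.
Proof. by have /asboolP[_ e] := grouplikeP f; exact: e. Qed.

Lemma grouplike_evalM f s t :
  grouplike_eval f (s * t)%g = grouplike_eval f s * grouplike_eval f t.
Proof.
have /asboolP[cf _] := grouplikeP f.
by rewrite /grouplike_eval -mbasisM -fdual_comulE [fdual_comul _]cf
  fdual_eval_tens.
Qed.

Lemma eval_grouplike_mul f g s :
  grouplike_eval (f * g)%g s = grouplike_eval f s * grouplike_eval g s.
Proof. exact: monoid_dual_mulE. Qed.

Lemma eval_grouplike_one s :
  grouplike_eval (1%g : grouplike (finite_dual kS)) s = 1.
Proof. exact: monoid_dual_oneE. Qed.

End GroupLikeEval.

Section WeightedSum.
Context {k : fieldType} {S : choiceType} {A : algType k}.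
Implicit Types (phi : S -> k) (c : {malg A[S]}).

Definition weighted_sum phi c : A := \sum_(s <- msupp c) phi s *: c@_s.

Lemma weighted_sum_widen phi (d : {fset S}) c : (msupp c `<=` d)%fset ->
  weighted_sum phi c = \sum_(s <- d) phi s *: c@_s.
Proof.
move=> le; rewrite /weighted_sum (big_fset_incl _ le) //= => s _.
by move=> /mcoeff_outdom ->; rewrite scaler0.
Qed.

(** The coefficients of c lie in A, so that formal sums form a module over A;
    scalars of k act on them through l%:A. *)
Lemma weighted_sum_linear phi (l : k) c c' :
  weighted_sum phi (l%:A *: c + c')
  = l *: weighted_sum phi c + weighted_sum phi c'.
Proof.
pose d := (msupp c `|` msupp c' `|` msupp (l%:A *: c + c')%R)%fset.
rewrite !(@weighted_sum_widen _ d); try by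
  apply/fsubsetP => s sx; rewrite !inE sx ?orbT.
rewrite scaler_sumr -big_split /=; apply: eq_bigr => s _.
rewrite mcoeffD mcoeffZ -scalerAl mul1r scalerDr !scalerA.
by rewrite [phi s * l]mulrC.
Qed.

Lemma weighted_sumU phi s (a : A) :
  weighted_sum phi << a *g s >> = phi s *: a.
Proof.
by rewrite (@weighted_sum_widen _ [fset s]%fset) ?msuppU_le // big_seq_fset1
  mcoeffUU.
Qed.

End WeightedSum.

Section Scaling.
Context {k : fieldType} {S : monoidType} {A : algType k} {Ad : S -> {pred A}}.
Hypothesis gradA : is_grading Ad.
Implicit Types (phi psi : S -> k) (a b : A) (c : {malg A[S]}).

Let component_proof a : { c : {malg A[S]} |
  (forall s, c@_s \in Ad s) /\ a = \sum_(s <- msupp c) c@_s }.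
Proof.
by apply: cid; have [c [cP _]] := grading_direct_sum gradA a; exists c.
Qed.

Definition components a : {malg A[S]} := sval (component_proof a).

Lemma components_homog a s : (components a)@_s \in Ad s.
Proof. exact: (svalP (component_proof a)).1. Qed.

Lemma components_sum a : a = \sum_(s <- msupp (components a)) (components a)@_s.
Proof. exact: (svalP (component_proof a)).2. Qed.

Let weighted_sum1 c :
  weighted_sum (fun=> 1 : k) c = \sum_(s <- msupp c) c@_s.
Proof. by apply: eq_bigr => s _; rewrite scale1r. Qed.

Lemma components_unique a c : (forall s, c@_s \in Ad s) ->
  a = weighted_sum (fun=> 1) c -> components a = c.
Proof.
move=> hc ac; have [c0 [_ uniq]] := grading_direct_sum gradA a.
rewrite -(uniq c); last by rewrite -weighted_sum1.
by symmetry; apply: uniq; exact: (svalP (component_proof a)).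
Qed.

(** The right-hand side has homogeneous coefficients and sums to l *: a + b, so
    uniqueness of the decomposition identifies it. *)
Lemma components_linear (l : k) a b :
  components (l *: a + b) = l%:A *: components a + components b.
Proof.
apply: components_unique => [s|]; last first.
  by rewrite weighted_sum_linear !weighted_sum1 -!components_sum.
rewrite mcoeffD mcoeffZ -scalerAl mul1r.
by have [_ ->] := grading_subspace gradA s; rewrite // components_homog.
Qed.

Lemma components_of_homog s a : a \in Ad s -> components a = << a *g s >>.
Proof.
move=> as_; apply: components_unique => [t|]; last first.
  by rewrite weighted_sumU scale1r.
rewrite mcoeffU; case: eqP => [<- //|_].
by rewrite mulr0n; have [] := grading_subspace gradA t.
Qed.

Definition scaling phi a : A := weighted_sum phi (components a).

Lemma scaling_linear phi : linear (scaling phi).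
Proof.
by move=> l a b; rewrite /scaling components_linear weighted_sum_linear.
Qed.

HB.instance Definition _ phi :=
  GRing.isLinear.Build k A A *:%R (scaling phi) (scaling_linear phi).

Lemma scaling_homog phi s a : a \in Ad s -> scaling phi a = phi s *: a.
Proof.
by move=> /components_of_homog; rewrite /scaling => ->; exact: weighted_sumU.
Qed.

(** By linearity it is enough to multiply two homogeneous elements. *)
Lemma scalingM phi : (forall s t, phi (s * t)%g = phi s * phi t) ->
  {morph scaling phi : a b / a * b}.
Proof.
move=> phiM a b; rewrite [in LHS](components_sum a) [in LHS](components_sum b).
rewrite mulr_suml linear_sum mulr_suml.
apply: eq_bigr => s _; rewrite mulr_sumr linear_sum mulr_sumr.
apply: eq_bigr => t _.
rewrite /= (@scaling_homog _ (s * t)%g) ?phiM; last first.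
  by apply: (grading_mul gradA); exact: components_homog.
by rewrite -scalerAl -scalerAr scalerA.
Qed.

Lemma scaling_comp phi psi a :
  scaling phi (scaling psi a) = scaling (fun s => phi s * psi s) a.
Proof.
rewrite [scaling psi a]/scaling /weighted_sum linear_sum; apply: eq_bigr => s _.
rewrite linearZ /= (scaling_homog _ (components_homog a s)) scalerA.
by rewrite mulrC.
Qed.

Lemma scaling_const1 a : scaling (fun=> 1) a = a.
Proof. by rewrite /scaling weighted_sum1 -components_sum. Qed.

End Scaling.

(* An action of a monoid M on A is a monoid morphism M -> End(A).  The bare
   existence of such a morphism is satisfied by the trivial one, so the second
   conjunct records which action is meant: f scales A_s by f(s).  When the unit
   of A is not homogeneous of degree 1 the scaling maps need not preserve it,
   and only the first conjunct is asserted. *)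
Theorem corollary2p15 (k : fieldType) (char0 : [pchar k] =i pred0)
    (S : monoidType) (A : algType k) (Ad : S -> {pred A})
    (gradA : is_grading Ad) :
  exists alpha : grouplike (finite_dual (monoid_algebra k S)) -> alg_end A,
    monoid.monoid_morphism alpha /\
    (1 \in Ad 1%g ->
     forall (f : grouplike (finite_dual (monoid_algebra k S))) (s : S) (a : A),
       a \in Ad s -> alpha f a = finite_dual_fun (grouplike_val f) (mbasis s) *: a).
Proof.
have [one_homog|one_inhomog] := boolP (1 \in Ad 1%g); last first.
  by exists (fun=> 1%g); split=> //; split=> // f g; rewrite mulg1.
pose act f : A -> A := scaling gradA (grouplike_eval f).
have act_monoid f : monoid_morphism (act f).
  split; last by apply: scalingM => s t; exact: grouplike_evalM.
  by rewrite /act (scaling_homog _ _ one_homog) grouplike_eval1 scale1r.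
pose alpha f : alg_end A := HB.pack (act f)
  (GRing.isLinear.Build k A A *:%R (act f) (scaling_linear gradA _))
  (GRing.isMonoidMorphism.Build A A (act f) (act_monoid f)).
exists alpha; split; last by move=> _ f s a; exact: scaling_homog.
split=> [|f g]; apply: alg_endP => a.
  rewrite -[RHS](scaling_const1 gradA); congr (scaling gradA _ a).
  by apply/funext => s; exact: eval_grouplike_one.
rewrite -[RHS]/(act f (act g a)) /act scaling_comp.
by congr (scaling gradA _ a); apply/funext => s; exact: eval_grouplike_mul.
Qed.
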